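(* Let $X\subseteq\{\mathbf{D},\mathbf{T},\mathbf{4}\}$. Every formula valid in the class $\mathcal{C}^X_{\mathbf{fdc}}$ (i.e. forced at every world of every model based on a forward and downward confluent $X$-frame) is derivable in $\mathbf{LIK}X$.
   Context: Formulas: $A::=p\mid A\supset A\mid \top\mid\bot\mid A\vee A\mid A\wedge A\mid \square A\mid \lozenge A$; $\neg A:=A\supset\bot$. $\mathbf{LIK}X$: axioms of intuitionistic propositional logic, $(\mathbf{K}_\square)\ \square(p\supset q)\supset(\square p\supset\square q)$, $(\mathbf{K}_\lozenge)\ \square(p\supset q)\supset(\lozenge p\supset\lozenge q)$, $(\mathbf{DP})\ \lozenge(p\vee q)\supset\lozenge p\vee\lozenge q$, $(\mathbf{RV})\ \square(p\vee q)\supset\lozenge p\vee\square q$, $(\mathbf{N})\ \neg\lozenge\bot$, plus $\lozenge\top$ if $\mathbf{D}\in X$, $(\square p\supset p)\wedge(p\supset\lozenge p)$ if $\mathbf{T}\in X$, $(\square p\supset\square\square p)\wedge(\lozenge\lozenge p\supset\lozenge p)$ if $\mathbf{4}\in X$ (with substitution instances), closed under modus ponens and necessitation (from $A$ infer $\square A$). A frame $(W,\leq,R)$: $W\neq\emptyset$, $\leq$ a preorder, $R$ binary relation. Forward confluent: $x\leq x'$ and $Rxy$ imply some $y'$ with $Rx'y'$, $y\leq y'$. Downward confluent: $x\leq x'$ and $Rx'y$ imply some $z$ with $Rxz$, $z\leq y$. An $X$-frame has $R$ serial if $\mathbf{D}\in X$, reflexive if $\mathbf{T}\in X$, transitive if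 $\mathbf{4}\in X$. Models add $V:\mathbf{At}\to\wp(W)$ with $\leq$-upward closed values. Forcing: $x\Vdash p$ iff $x\in V(p)$; $\top,\bot,\wedge,\vee$ pointwise; $x\Vdash A\supset B$ iff for all $x'\geq x$, $x'\Vdash A$ implies $x'\Vdash B$; $x\Vdash\square A$ iff $y\Vdash A$ for all $y$ with $Rxy$; $x\Vdash\lozenge A$ iff $y\Vdash A$ for some $y$ with $Rxy$. *)

(* Defs.v *)
From Stdlib Require Import Relations.

Section Syntax.
Variable At : Type.

Inductive formula : Type :=
  | Atom (p : At)
  | Imp (A B : formula)
  | Top
  | Bot
  | Or (A B : formula)
  | And (A B : formula)
  | Box (A : formula)
  | Dia (A : formula).
End Syntax.

Arguments Atom {At} p.
Arguments Imp {At} A B.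
Arguments Top {At}.
Arguments Bot {At}.
Arguments Or {At} A B.
Arguments And {At} A B.
Arguments Box {At} A.
Arguments Dia {At} A.

Declare Scope lik_scope.
Delimit Scope lik_scope with lik.
Bind Scope lik_scope with formula.
Notation "A ⊃ B" := (Imp A B) (at level 65, right associativity) : lik_scope.
Notation "A ∨ B" := (Or A B) (at level 60, right associativity) : lik_scope.
Notation "A ∧ B" := (And A B) (at level 55, right associativity) : lik_scope.
Notation "⊤" := Top (at level 0) : lik_scope.
Notation "⊥" := Bot (at level 0) : lik_scope.
Notation "□ A" := (Box A) (at level 35, right associativity) : lik_scope.
Notation "◇ A" := (Dia A) (at level 35, right associativity) : lik_scope.
Notation "¬ A" := (Imp A Bot) (at level 35, right associativity) : lik_scope.

Inductive ext_axiom : Set := axD | axT | ax4.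

(* Axioms are schemes in arbitrary formulas, so no substitution rule is
   needed. A set X of extension axioms is a predicate on [ext_axiom]. *)
Section LIK.
Variable At : Type.
Local Open Scope lik_scope.
Implicit Types A B C : formula At.

Inductive IPL_axiom : formula At -> Prop :=
  | ax_imp_K A B : IPL_axiom (A ⊃ B ⊃ A)
  | ax_imp_S A B C : IPL_axiom ((A ⊃ B ⊃ C) ⊃ (A ⊃ B) ⊃ A ⊃ C)
  | ax_and_l A B : IPL_axiom (A ∧ B ⊃ A)
  | ax_and_r A B : IPL_axiom (A ∧ B ⊃ B)
  | ax_and_i A B : IPL_axiom (A ⊃ B ⊃ A ∧ B)
  | ax_or_l A B : IPL_axiom (A ⊃ A ∨ B)
  | ax_or_r A B : IPL_axiom (B ⊃ A ∨ B)
  | ax_or_e A B C : IPL_axiom ((A ⊃ C) ⊃ (B ⊃ C) ⊃ A ∨ B ⊃ C)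
  | ax_top : IPL_axiom ⊤
  | ax_bot A : IPL_axiom (⊥ ⊃ A).

Inductive LIK_axiom (X : ext_axiom -> Prop) : formula At -> Prop :=
  | ax_IPL A : IPL_axiom A -> LIK_axiom X A
  | ax_K_box A B : LIK_axiom X (□ (A ⊃ B) ⊃ (□ A ⊃ □ B))
  | ax_K_dia A B : LIK_axiom X (□ (A ⊃ B) ⊃ (◇ A ⊃ ◇ B))
  | ax_DP A B : LIK_axiom X (◇ (A ∨ B) ⊃ ◇ A ∨ ◇ B)
  | ax_RV A B : LIK_axiom X (□ (A ∨ B) ⊃ ◇ A ∨ □ B)
  | ax_N : LIK_axiom X (¬ ◇ ⊥)
  | ax_D : X axD -> LIK_axiom X (◇ ⊤)
  | ax_T A : X axT -> LIK_axiom X ((□ A ⊃ A) ∧ (A ⊃ ◇ A))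
  | ax_4 A : X ax4 -> LIK_axiom X ((□ A ⊃ □ □ A) ∧ (◇ ◇ A ⊃ ◇ A)).

Inductive LIK (X : ext_axiom -> Prop) : formula At -> Prop :=
  | LIK_ax A : LIK_axiom X A -> LIK X A
  | LIK_mp A B : LIK X (A ⊃ B) -> LIK X A -> LIK X B
  | LIK_nec A : LIK X A -> LIK X (□ A).
End LIK.

Arguments LIK {At} X A.

Record frame : Type := Frame {
  world : Type;
  ile : relation world;
  acc : relation world;
  world_inhabited : inhabited world;
  le_preorder : preorder world ile
}.

Arguments ile {f} x y.
Arguments acc {f} x y.

Definition forward_confluent (F : frame) : Prop :=
  forall x x' y : world F, ile x x' -> acc x y ->
    exists y', acc x' y' /\ ile y y'.

Definition downward_confluent (F : frame) : Prop :=
  forall x x' y : world F, ile x x' -> acc x' y ->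
    exists z, acc x z /\ ile z y.

Definition serial (F : frame) : Prop :=
  forall x : world F, exists y, acc x y.

Definition X_frame (X : ext_axiom -> Prop) (F : frame) : Prop :=
  (X axD -> serial F) /\
  (X axT -> reflexive (world F) acc) /\
  (X ax4 -> transitive (world F) acc).

Definition C_fdc (X : ext_axiom -> Prop) (F : frame) : Prop :=
  X_frame X F /\ forward_confluent F /\ downward_confluent F.

Record model (At : Type) (F : frame) : Type := Model {
  val : At -> world F -> Prop;
  val_up : forall p x x', ile x x' -> val p x -> val p x'
}.

Arguments val {At F} m p x.

Fixpoint forces {At : Type} {F : frame} (M : model At F) (x : world F)
    (A : formula At) : Prop :=
  match A with
  | Atom p => val M p x
  | Imp A B => forall x', ile x x' -> forces M x' A -> forces M x' B
  | Top => True
  | Bot => False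
  | Or A B => forces M x A \/ forces M x B
  | And A B => forces M x A /\ forces M x B
  | Box A => forall y, acc x y -> forces M y A
  | Dia A => exists y, acc x y /\ forces M y A
  end.

Definition valid_in {At : Type} (C : frame -> Prop) (A : formula At) : Prop :=
  forall F : frame, C F ->
  forall (M : model At F) (x : world F), forces M x A.

(* Main.v *)
(** Canonical model argument.  Worlds are the prime theories ordered by
    inclusion, and [Δ] is accessible from [Γ] when [□A ∈ Γ] implies [A ∈ Δ] and
    [A ∈ Δ] implies [◇A ∈ Γ].  Both confluence properties and both modal cases
    of the truth lemma are instances of one separation statement
    ([accessible_separation]): a successor of [Γ] including a filter [S] and
    avoiding an ideal [J] exists as soon as [□(D ⊃ E ∨ F) ∈ Γ] with [D ∈ S] and
    [F ∈ J] forces [◇E ∈ Γ].  Axiom RV is what verifies this condition for [□]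
    and for downward confluence, axioms DP and N for [◇] and for forward
    confluence. *)

From Stdlib Require Import Relations Classical.
From mathcomp.classical Require classical_sets.
Require Import Defs.

Set Bullet Behavior "Strict Subproofs".

Section Completeness.
Variables (At : Type) (X : ext_axiom -> Prop).
Local Open Scope lik_scope.
Implicit Types (A B C D E F : formula At) (Q S I J : formula At -> Prop).

(** Closure under necessitation is left out: a theory describes a single world, and what holds there
    may fail at its successors. *)
Definition theory Q : Prop :=
  (forall A, LIK X A -> Q A) /\ (forall A B, Q (A ⊃ B) -> Q A -> Q B).

(** For a theory [Q] this is the theory generated by [Q] and [A], by the deduction theorem. *)
Definition adjoin Q A : formula At -> Prop := fun B => Q (A ⊃ B).

Definition unbox Q : formula At -> Prop := fun B => Q (□ B).

Definition prime_theory Q : Prop :=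
  theory Q /\ ~ Q ⊥ /\ forall A B, Q (A ∨ B) -> Q A \/ Q B.

(** * Theories *)

Lemma theory_LIK : theory (LIK X).
Proof. split; [easy | exact (@LIK_mp At X)]. Qed.

Lemma theory_ax Q A : theory Q -> LIK_axiom At X A -> Q A.
Proof. intros [HL _] HA. now apply HL, LIK_ax. Qed.

Lemma theory_ipl Q A : theory Q -> IPL_axiom At A -> Q A.
Proof. intros HQ HA. now apply theory_ax; [| apply ax_IPL]. Qed.

Lemma theory_mp Q A B : theory Q -> Q (A ⊃ B) -> Q A -> Q B.
Proof. intros [_ Hmp]. apply Hmp. Qed.

Lemma adjoin_incl Q A B : theory Q -> Q B -> adjoin Q A B.
Proof.
intros HQ HB. apply (theory_mp Q B); [easy | | easy].
apply theory_ipl; [easy | constructor].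
Qed.

Lemma adjoin_self Q A : theory Q -> adjoin Q A A.
Proof.
intros HQ. unfold adjoin.
(* The combinator derivation [S K K] of [A ⊃ A]. *)
apply (theory_mp Q (A ⊃ A ⊃ A)); [easy | | apply theory_ipl; [easy | constructor]].
apply (theory_mp Q (A ⊃ (A ⊃ A) ⊃ A)); [easy | |];
  apply theory_ipl; try easy; constructor.
Qed.

Lemma theory_adjoin Q A : theory Q -> theory (adjoin Q A).
Proof.
intros HQ; split.
- intros B HB. now apply adjoin_incl; [| apply HQ].
- intros B C HBC HB. unfold adjoin in *.
  apply (theory_mp Q (A ⊃ B)); [easy | | easy].
  apply (theory_mp Q (A ⊃ B ⊃ C)); [easy | | easy].
  apply theory_ipl; [easy | constructor].
Qed.

(* Natural-deduction style introduction: it lets implications be proved by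
   reasoning inside an arbitrary larger theory. *)
Lemma theory_imp_intro Q A B : theory Q ->
  (forall Q', theory Q' -> (forall C, Q C -> Q' C) -> Q' A -> Q' B) ->
  Q (A ⊃ B).
Proof.
intros HQ H. apply (H (adjoin Q A)).
- now apply theory_adjoin.
- intros C. now apply adjoin_incl.
- now apply adjoin_self.
Qed.

Lemma theory_and Q A B : theory Q -> Q (A ∧ B) <-> Q A /\ Q B.
Proof.
intros HQ; split.
- intros H; split; refine (theory_mp _ _ _ HQ _ H);
    (apply theory_ipl; [easy | constructor]).
- intros [HA HB]. refine (theory_mp _ _ _ HQ _ HB).
  refine (theory_mp _ _ _ HQ _ HA). apply theory_ipl; [easy | constructor].
Qed.

Lemma theory_or_introl Q A B : theory Q -> Q A -> Q (A ∨ B).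
Proof.
intros HQ. apply theory_mp; [easy |]. apply theory_ipl; [easy | constructor].
Qed.

Lemma theory_or_intror Q A B : theory Q -> Q B -> Q (A ∨ B).
Proof.
intros HQ. apply theory_mp; [easy |]. apply theory_ipl; [easy | constructor].
Qed.

Lemma theory_or_elim Q A B C : theory Q ->
  Q (A ∨ B) -> Q (A ⊃ C) -> Q (B ⊃ C) -> Q C.
Proof.
intros HQ HAB HA HB. refine (theory_mp _ _ _ HQ _ HAB).
refine (theory_mp _ _ _ HQ _ HB). refine (theory_mp _ _ _ HQ _ HA).
apply theory_ipl; [easy | constructor].
Qed.

Lemma theory_top Q : theory Q -> Q ⊤.
Proof. intros HQ. apply theory_ipl; [easy | constructor]. Qed.

Lemma theory_efq Q A : theory Q -> Q ⊥ -> Q A.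
Proof.
intros HQ. apply theory_mp; [easy |]. apply theory_ipl; [easy | constructor].
Qed.

Lemma LIK_incl Q A B : theory Q -> LIK X (A ⊃ B) -> Q A -> Q B.
Proof. intros HQ HAB. apply theory_mp; [easy |]. now apply HQ. Qed.

Lemma LIK_imp_intro A B : (forall Q, theory Q -> Q A -> Q B) -> LIK X (A ⊃ B).
Proof.
intros H. apply theory_imp_intro; [exact theory_LIK |]. intros Q HQ _. now apply H.
Qed.

Lemma theory_imp_trans Q A B C : theory Q -> Q (A ⊃ B) -> Q (B ⊃ C) -> Q (A ⊃ C).
Proof.
intros HQ HAB HBC. apply theory_imp_intro; [easy |]. intros Q' HQ' Hi HA.
apply (theory_mp Q' B); auto. apply (theory_mp Q' A); auto.
Qed.

(** * Modal closure of theories and prime theories *)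

Lemma theory_unbox Q : theory Q -> theory (unbox Q).
Proof.
intros HQ; split.
- intros A HA. now apply HQ, LIK_nec.
- intros A B HAB HA. unfold unbox in *. refine (theory_mp _ _ _ HQ _ HA).
  refine (theory_mp _ _ _ HQ _ HAB). apply theory_ax; [easy | apply ax_K_box].
Qed.

Lemma theory_dia_mono Q A B : theory Q -> Q (□ (A ⊃ B)) -> Q (◇ A) -> Q (◇ B).
Proof.
intros HQ HAB HA. refine (theory_mp _ _ _ HQ _ HA).
refine (theory_mp _ _ _ HQ _ HAB). apply theory_ax; [easy | apply ax_K_dia].
Qed.

Lemma prime_dia_or Q A B : prime_theory Q -> Q (◇ (A ∨ B)) -> Q (◇ A) \/ Q (◇ B).
Proof.
intros [HQ [_ Hor]] H. apply Hor. refine (theory_mp _ _ _ HQ _ H).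
apply theory_ax; [easy | apply ax_DP].
Qed.

Lemma prime_box_or Q A B : prime_theory Q -> Q (□ (A ∨ B)) -> Q (◇ A) \/ Q (□ B).
Proof.
intros [HQ [_ Hor]] H. apply Hor. refine (theory_mp _ _ _ HQ _ H).
apply theory_ax; [easy | apply ax_RV].
Qed.

Lemma prime_not_dia_bot Q : prime_theory Q -> ~ Q (◇ ⊥).
Proof.
intros [HQ [Hbot _]] H. apply Hbot. refine (theory_mp _ _ _ HQ _ H).
apply theory_ax; [easy | apply ax_N].
Qed.

(** * Separation *)

Section Separation.
Variables (T I : formula At -> Prop).
Hypothesis theory_T : theory T.
Hypothesis ideal_inhabited : exists C, I C.
Hypothesis ideal_or : forall A B, I A -> I B -> I (A ∨ B).
Hypothesis disjoint_T : forall A, T A -> ~ I A.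

Let separating Q : Prop :=
  theory Q /\ (forall A, T A -> Q A) /\ (forall A, Q A -> ~ I A).

Lemma maximal_separating_theory : exists Q, separating Q /\
  forall Q', separating Q' -> (forall A, Q A -> Q' A) -> forall A, Q' A -> Q A.
Proof.
(* The empty set is admitted so that the union of the empty chain qualifies. *)
destruct (@classical_sets.Zorn_bigcup (formula At)
  (fun Q => forall A, Q A -> separating Q)) as [Q [HQ Hmax]].
- intros G HG Htot A0 [Q0 GQ0 Q0A0].
  destruct (HG _ GQ0 _ Q0A0) as [HQ0 [HT0 _]].
  split; [split | split].
  + intros A HA. exists Q0; [easy | now apply HQ0].
  + intros A B [Q1 G1 H1] [Q2 G2 H2].
    destruct (Htot _ _ G1 G2) as [H12 | H21].
    * exists Q2; [easy |]. apply (theory_mp Q2 A); [| now apply H12 | easy].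
      now apply (HG _ G2 _ H2).
    * exists Q1; [easy |]. apply (theory_mp Q1 A); [| easy | now apply H21].
      now apply (HG _ G1 _ H1).
  + intros A HA. exists Q0; [easy | now apply HT0].
  + intros A [Q1 G1 H1]. now apply (HG _ G1 _ H1).
- assert (HT : separating T) by (split; auto).
  assert (Hne : exists A, Q A).
  (* An empty maximal set would be properly extended by [T], which contains [⊤]. *)
  { apply NNPP. intros Hempty. apply (Hmax T); [| easy]. split.
    - intros A HA. exfalso. eauto.
    - intros Hsub. apply Hempty. exists ⊤. apply Hsub. now apply theory_top. }
  destruct Hne as [A0 HA0]. exists Q. split; [eauto |].
  intros Q' HQ' Hsub. apply NNPP. intros Hnot. now apply (Hmax Q').
Qed.

(** By maximality, adjoining a missing formula makes the theory meet the ideal. Were both disjuncts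
    of [A ∨ B] missing, the theory would contain a disjunction of two ideal elements. *)
Lemma prime_separation :
  exists Q, prime_theory Q /\ (forall A, T A -> Q A) /\ (forall A, Q A -> ~ I A).
Proof.
destruct maximal_separating_theory as [Q [[HQ [HTQ HQI]] Hmax]].
assert (Hadjoin : forall A, ~ Q A -> exists C, Q (A ⊃ C) /\ I C).
{ intros A HA. apply NNPP. intros Hno. apply HA. apply (Hmax (adjoin Q A)).
  - split; [now apply theory_adjoin | split].
    + intros B HB. apply adjoin_incl; auto.
    + intros B HB HIB. apply Hno. now exists B.
  - intros B. now apply adjoin_incl.
  - now apply adjoin_self. }
exists Q. split; [split; [easy | split] | easy].
- intros Hbot. destruct ideal_inhabited as [C HC]. apply (HQI C); [| easy].
  now apply theory_efq.
- intros A B HAB. apply NNPP. intros Hno.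
  destruct (Hadjoin A) as [C [HAC HC]]; [tauto |].
  destruct (Hadjoin B) as [D [HBD HD]]; [tauto |].
  apply (HQI (C ∨ D)); [| auto].
  apply (theory_or_elim Q A B); auto; apply theory_imp_intro; auto;
    intros Q' HQ' Hi H.
  + apply theory_or_introl; [easy |]. apply (theory_mp Q' A); auto.
  + apply theory_or_intror; [easy |]. apply (theory_mp Q' B); auto.
Qed.
End Separation.

(** * The canonical model *)

Definition canonical_acc Q Q' : Prop :=
  (forall A, Q (□ A) -> Q' A) /\ (forall A, Q' A -> Q (◇ A)).

Lemma accessible_separation Q S J : prime_theory Q ->
  (exists D, S D) -> (forall A B, S A -> S B -> S (A ∧ B)) ->
  (exists F, J F) -> (forall A B, J A -> J B -> J (A ∨ B)) ->
  (forall D E F, S D -> J F -> Q (□ (D ⊃ E ∨ F)) -> Q (◇ E)) ->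
  exists Q', prime_theory Q' /\ canonical_acc Q Q' /\
    (forall D, S D -> Q' D) /\ (forall F, J F -> ~ Q' F).
Proof.
intros HQ [D0 HD0] HSand [F0 HF0] HJor Hsep.
assert (HQt : theory Q) by apply HQ.
assert (HU : theory (unbox Q)) by now apply theory_unbox.
(* [T] is the theory generated by [unbox Q] and [S]; [I] is the ideal generated by [J] and the
   formulas whose diamond is missing from [Q]. A prime theory including [T] and avoiding [I] is thus
   accessible from [Q]. *)
set (T := fun B => exists2 D, S D & unbox Q (D ⊃ B)).
set (I := fun C => exists E F, ~ Q (◇ E) /\ J F /\ LIK X (C ⊃ E ∨ F)).
assert (HI1 : forall C, ~ Q (◇ C) -> I C).
{ intros C HC. exists C, F0. split; [easy | split; [easy |]].
  apply LIK_imp_intro. intros Q' HQ'. now apply theory_or_introl. }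
assert (HI2 : forall F, J F -> I F).
(* Axiom N allows [⊥] in the role of [E]. *)
{ intros F HF. exists ⊥, F. split; [now apply prime_not_dia_bot | split; [easy |]].
  apply LIK_imp_intro. intros Q' HQ'. now apply theory_or_intror. }
destruct (prime_separation T I) as [Q' [HQ' [HTQ' HQ'I]]].
- split.
  + intros A HA. exists D0; [easy |]. apply adjoin_incl; [easy |]. now apply HU.
  + intros A B [D1 HD1 HAB] [D2 HD2 HA]. exists (D1 ∧ D2); [auto |].
    apply theory_imp_intro; [easy |]. intros R HR Hi HD.
    apply theory_and in HD as [HRD1 HRD2]; [| easy].
    apply (theory_mp R A); [easy | |].
    * apply (theory_mp R D1); auto.
    * apply (theory_mp R D2); auto.
- exists F0. auto.
- intros A B [E1 [F1 [HE1 [HF1 HA]]]] [E2 [F2 [HE2 [HF2 HB]]]].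
  exists (E1 ∨ E2), (F1 ∨ F2). split; [| split; [auto |]].
  (* By DP, formulas whose diamond is missing are closed under disjunction. *)
  + intros H. destruct (prime_dia_or _ _ _ HQ H); contradiction.
  + apply LIK_imp_intro. intros R HR HAB.
    apply (theory_or_elim R A B); auto; apply theory_imp_intro; auto;
      intros R' HR' _ H.
    * apply (theory_or_elim R' E1 F1); [easy | now apply (LIK_incl R' A) | |];
        apply theory_imp_intro; auto; intros R2 HR2 _ H2.
      -- now apply theory_or_introl, theory_or_introl.
      -- now apply theory_or_intror, theory_or_introl.
    * apply (theory_or_elim R' E2 F2); [easy | now apply (LIK_incl R' B) | |];
        apply theory_imp_intro; auto; intros R2 HR2 _ H2.
      -- now apply theory_or_introl, theory_or_intror.
      -- now apply theory_or_intror, theory_or_intror.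
- intros A [D HD HDA] [E [F [HE [HF HA]]]]. apply HE, (Hsep D E F); auto.
  apply (theory_imp_trans (unbox Q) D A); auto. now apply HU.
- exists Q'. split; [easy | split; [split | split]].
  + intros A HA. apply HTQ'. exists D0; [easy |]. now apply adjoin_incl.
  + intros A HA. apply NNPP. intros HnA. apply (HQ'I A); auto.
  + intros D HD. apply HTQ'. exists D; [easy |]. now apply adjoin_self.
  + intros F HF HQF. apply (HQ'I F); auto.
Qed.

Lemma provable_and A B : LIK X A -> LIK X B -> LIK X (A ∧ B).
Proof. intros HA HB. now apply (theory_and _ _ _ theory_LIK). Qed.

Lemma below_or C A B : LIK X (A ⊃ C) -> LIK X (B ⊃ C) -> LIK X (A ∨ B ⊃ C).
Proof.
intros HA HB. apply LIK_imp_intro. intros Q HQ HAB.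
apply (theory_or_elim Q A B); auto; now apply HQ.
Qed.

Lemma LIK_imp_refl A : LIK X (A ⊃ A).
Proof. now apply LIK_imp_intro. Qed.

Lemma LIK_top : LIK (At := At) X ⊤.
Proof. apply theory_top, theory_LIK. Qed.

(* With [J] the set of refutable formulas, the condition of
   [accessible_separation] only asks that [◇D ∈ Q] for [D ∈ S]. *)
Lemma dia_separation Q S : prime_theory Q ->
  (exists D, S D) -> (forall A B, S A -> S B -> S (A ∧ B)) ->
  (forall D, S D -> Q (◇ D)) ->
  exists Q', prime_theory Q' /\ canonical_acc Q Q' /\ (forall D, S D -> Q' D).
Proof.
intros HQ HSne HSand HS. assert (HQt : theory Q) by apply HQ.
destruct (accessible_separation Q S (fun F => LIK X (F ⊃ ⊥)))
  as [Q' [HQ' [Hacc [HSQ' _]]]]; auto.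
- exists ⊥. apply LIK_imp_refl.
- intros A B. apply below_or.
- intros D E F HD HF H.
  (* [◇ D] yields [◇ (E ∨ F)], which DP splits; since [F] is refutable, [◇ F] would yield [◇ ⊥],
     against N. *)
  destruct (prime_dia_or Q E F HQ) as [HE | HdF]; [| easy |].
  + now apply (theory_dia_mono Q D); auto.
  + exfalso. apply (prime_not_dia_bot Q HQ).
    apply (theory_dia_mono Q F); auto. now apply HQt, LIK_nec.
- now exists Q'.
Qed.

(* With [S] the set of theorems, the condition of [accessible_separation] only
   asks that [□F ∉ Q] for [F ∈ J]. *)
Lemma box_separation Q J : prime_theory Q ->
  (exists F, J F) -> (forall A B, J A -> J B -> J (A ∨ B)) ->
  (forall F, J F -> ~ Q (□ F)) ->
  exists Q', prime_theory Q' /\ canonical_acc Q Q' /\ (forall F, J F -> ~ Q' F).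
Proof.
intros HQ HJne HJor HJ.
destruct (accessible_separation Q (LIK X) J)
  as [Q' [HQ' [Hacc [_ HJQ']]]]; auto.
- exists ⊤. exact LIK_top.
- exact provable_and.
- intros D E F HD HF H.
  (* As [D] is a theorem, [Q] contains [□ (E ∨ F)], which RV splits. *)
  destruct (prime_box_or Q E F HQ) as [HE | HbF]; [| easy |].
  + assert (HU : theory (unbox Q)) by now apply theory_unbox, HQ.
    apply (theory_mp (unbox Q) D); [easy | exact H | now apply HU].
  + exfalso. now apply (HJ F).
- now exists Q'.
Qed.

(** * Prime theories witnessing or refuting a single formula *)

Lemma prime_dia_witness Q A : prime_theory Q -> Q (◇ A) ->
  exists Q', prime_theory Q' /\ canonical_acc Q Q' /\ Q' A.
Proof.
intros HQ HA. assert (HQt : theory Q) by apply HQ.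
(* The principal filter of [A]. *)
destruct (dia_separation Q (fun D => LIK X (A ⊃ D))) as [Q' [HQ' [Hacc HS]]]; auto.
- exists A. apply LIK_imp_refl.
- intros B C HB HC. apply LIK_imp_intro. intros R HR HRA.
  apply theory_and; [easy |]. split; eapply LIK_incl; eauto.
- intros D HD. apply (theory_dia_mono Q A); auto. now apply HQt, LIK_nec.
- exists Q'. split; [easy | split; [easy |]]. apply HS, LIK_imp_refl.
Qed.

Lemma prime_box_witness Q A : prime_theory Q -> ~ Q (□ A) ->
  exists Q', prime_theory Q' /\ canonical_acc Q Q' /\ ~ Q' A.
Proof.
intros HQ HA. assert (HU : theory (unbox Q)) by now apply theory_unbox, HQ.
(* The principal ideal of [A]. *)
destruct (box_separation Q (fun F => LIK X (F ⊃ A))) as [Q' [HQ' [Hacc HJ]]]; auto.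
- exists A. apply LIK_imp_refl.
- intros B C. apply below_or.
- intros F HF H. now apply HA, (LIK_incl (unbox Q) F).
- exists Q'. split; [easy | split; [easy |]]. apply HJ, LIK_imp_refl.
Qed.

Lemma prime_avoiding Q B : theory Q -> ~ Q B ->
  exists Q', prime_theory Q' /\ (forall A, Q A -> Q' A) /\ ~ Q' B.
Proof.
intros HQ HB.
destruct (prime_separation Q (fun F => LIK X (F ⊃ B))) as [Q' [HQ' [Hi HJ]]]; auto.
- exists B. apply LIK_imp_refl.
- intros C D. apply below_or.
- intros F HF HFB. now apply HB, (LIK_incl Q F).
- exists Q'. split; [easy | split; [easy |]]. intros H. apply (HJ B H), LIK_imp_refl.
Qed.

(** * The canonical frame and the truth lemma *)

Definition cworld : Type := {Q | prime_theory Q}.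
Definition cle (x y : cworld) : Prop := forall A, proj1_sig x A -> proj1_sig y A.
Definition cacc (x y : cworld) : Prop := canonical_acc (proj1_sig x) (proj1_sig y).

Lemma cle_preorder : preorder cworld cle.
Proof.
split.
- now intros x A.
- intros x y z Hxy Hyz A HA. now apply Hyz, Hxy.
Qed.

Section CanonicalFrame.
(** This amounts to consistency of the logic; in the final proof an underivable formula provides the
    world. *)
Hypothesis cworld_inhabited : inhabited cworld.

Definition canonical_frame : frame :=
  Frame cworld cle cacc cworld_inhabited cle_preorder.

Definition canonical_model : model At canonical_frame :=
  Model At canonical_frame (fun p x => proj1_sig x (Atom p))
    (fun p x x' (Hxx' : cle x x') Hx => Hxx' (Atom p) Hx).

Lemma canonical_forward : forward_confluent canonical_frame.
Proof.
intros [Q HQ] [Q1 HQ1] [R HR] Hle [Hb Hd]. cbn in *.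
(* Any successor of [Q1] that includes [R] will do. *)
destruct (dia_separation Q1 R) as [R' [HR' [Hacc HRR']]]; auto.
- exists ⊤. now apply theory_top, HR.
- intros A B HA HB. now apply theory_and; [apply HR |].
- intros D HD. now apply Hle, Hd.
- now exists (exist _ R' HR').
Qed.

Lemma canonical_downward : downward_confluent canonical_frame.
Proof.
intros [Q HQ] [Q1 HQ1] [R HR] Hle [Hb Hd]. cbn in *.
(* Avoiding the complement of [R] means being included in [R]; primeness of [R] closes that
   complement under disjunction. *)
destruct (box_separation Q (fun F => ~ R F)) as [R' [HR' [Hacc HRR']]]; auto.
- exists ⊥. apply HR.
- intros A B HA HB HAB. destruct HR as [_ [_ Hor]]. now destruct (Hor A B HAB).
- intros F HF HbF. now apply HF, Hb, Hle.
- exists (exist _ R' HR'). split; [easy |]. intros A HA. apply NNPP.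
  intros HnA. now apply (HRR' A).
Qed.

(** For T and 4, the box and diamond conjuncts of the axiom give the two halves of [canonical_acc];
    for D, a successor is a witness of [◇ ⊤]. *)
Lemma canonical_X_frame : X_frame X canonical_frame.
Proof.
split; [| split].
- intros HD [Q HQ].
  destruct (prime_dia_witness Q ⊤ HQ) as [R [HR [Hacc _]]].
  + apply theory_ax; [apply HQ | now apply ax_D].
  + now exists (exist _ R HR).
- intros HT [Q HQ]. assert (HQt : theory Q) by apply HQ.
  assert (Hax : forall A, Q (□ A ⊃ A) /\ Q (A ⊃ ◇ A)).
  { intros A. apply theory_and; [easy |]. apply theory_ax; [easy | now apply ax_T]. }
  split; intros A HA; cbn in *; refine (theory_mp _ _ _ HQt _ HA); apply Hax.
- intros H4 [Q HQ] [Q1 HQ1] [Q2 HQ2] [Hb1 Hd1] [Hb2 Hd2]. cbn in *.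
  assert (HQt : theory Q) by apply HQ.
  assert (Hax : forall A, Q (□ A ⊃ □ □ A) /\ Q (◇ ◇ A ⊃ ◇ A)).
  { intros A. apply theory_and; [easy |]. apply theory_ax; [easy | now apply ax_4]. }
  split; intros A HA; cbn in *.
  + apply Hb2, Hb1. refine (theory_mp _ _ _ HQt _ HA). apply Hax.
  + apply (theory_mp Q (◇ ◇ A)); [easy | apply Hax | auto].
Qed.

Lemma canonical_truth A (x : world canonical_frame) :
  forces canonical_model x A <-> proj1_sig x A.
Proof.
revert x. induction A as [p | A IHA B IHB | | | A IHA B IHB | A IHA B IHB
  | A IHA | A IHA]; intros [Q HQ]; assert (HQt : theory Q) by apply HQ; cbn.
- easy.
- split.
  + intros H. apply NNPP. intros HnAB.
    (* [A ⊃ B] missing from [Q] says exactly that [adjoin Q A] lacks [B]. *)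
    destruct (prime_avoiding (adjoin Q A) B) as [Q' [HQ' [Hi HB]]]; auto.
    { now apply theory_adjoin. }
    apply HB. change (proj1_sig (exist _ Q' HQ') B). apply IHB, H.
    * intros C HC. now apply Hi, adjoin_incl.
    * apply IHA. now apply Hi, adjoin_self.
  + intros HAB x Hle HA. apply IHB, (theory_mp _ A).
    * apply (proj2_sig x).
    * now apply Hle.
    * now apply IHA.
- split; [intros _; now apply theory_top | easy].
- split; [easy | apply HQ].
- rewrite IHA, IHB. cbn. split.
  + intros [H | H]; [now apply theory_or_introl | now apply theory_or_intror].
  + apply HQ.
- rewrite IHA, IHB. cbn. now rewrite theory_and.
- split.
  + intros H. apply NNPP. intros HnA.
    destruct (prime_box_witness Q A HQ HnA) as [Q' [HQ' [Hacc HA]]].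
    apply HA. change (proj1_sig (exist _ Q' HQ') A). now apply IHA, H.
  + intros H y [Hb _]. now apply IHA, Hb.
- split.
  + intros [y [[_ Hd] Hy]]. now apply Hd, IHA.
  + intros H. destruct (prime_dia_witness Q A HQ H) as [Q' [HQ' [Hacc HA]]].
    exists (exist _ Q' HQ'). split; [easy | now apply IHA].
Qed.
End CanonicalFrame.

End Completeness.

Theorem theorem2 (At : Type) (X : ext_axiom -> Prop) (A : formula At) :
  valid_in (C_fdc X) A -> LIK X A.
Proof.
intros Hvalid. apply NNPP. intros HA.
destruct (prime_avoiding At X (LIK X) A) as [Q [HQ [_ HnA]]];
  [apply theory_LIK | easy |].
(* This world both inhabits the canonical frame and refutes [A]. *)
pose (x := exist _ Q HQ : cworld At X).
apply HnA. change (proj1_sig x A).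
apply (canonical_truth At X (inhabits x)), Hvalid.
split; [apply canonical_X_frame | split].
- apply canonical_forward.
- apply canonical_downward.
Qed.
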